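(* Define $f:[\tfrac12,1)\to\mathbb{R}$ by $$f(x)=\begin{cases} x^2-2x+2-h(x) & \text{if } \tfrac12\le x\le \tfrac{-1+\sqrt5}{2},\\[2pt] \dfrac{-2x^2+x+2}{1+x}-h(x) & \text{if } \tfrac{-1+\sqrt5}{2}\le x<1,\end{cases}$$ where $h$ is the binary entropy function. For every $p_{\max}\in[\tfrac12,1)$, the worst-case redundancy of optimal binary AIFV codes in terms of $p_{\max}$, i.e. the supremum of $r_{\rm AIFV}$ over all sources whose most likely symbol has probability exactly $p_{\max}$, equals $f(p_{\max})$.
   Context: Sources. A source is a finite alphabet $\mathcal X$ with $|\mathcal X|\ge 2$ (of arbitrary size) together with a probability distribution on $\mathcal X$ with strictly positive probabilities; symbols are emitted i.i.d. $p_{\max}$ is the largest symbol probability. $H(X)$ is the Shannon entropy in bits, $h(x)=-x\log_2 x-(1-x)\log_2(1-x)$. Code trees. A binary code tree is a finite rooted tree in which each node has at most one child along an edge labelled $0$ and at most one child along an edge labelled $1$. An internal node is complete if it has two children and incomplete if it has exactly one child. Binary AIFV code. It consists of two binary code trees $T_0,T_1$ such that: (1) in each tree the incomplete internal nodes are divided into master nodes and slave nodes; (2) in each tree the source symbols are assigned bijectively to the master nodes and leaves (slave nodes and complete internal nodes carry no symbol); (3) the child of a master node is a slave node, and the master node is connected to its grandchild by the code symbols $00$; (4) the root of $T_1$ has two children, and the child of the root of $T_1$ along $0$ is a slave node, which is connected to its (only) child by $1$. The root of $T_0$ may be a master node. The codeword of a symbol in a tree is the label string of the path from the root to its node (possibly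 the empty string, of length $0$). Encoding. The first symbol is encoded with $T_0$. If a symbol has been encoded by a leaf, the next symbol is encoded with $T_0$; if it has been encoded by a master node, the next symbol is encoded with $T_1$. Average code length. For an i.i.d. source the sequence of trees used is a Markov chain on $\{T_0,T_1\}$, with $P(T_1\mid T_i)$ equal to the total probability of the symbols assigned to master nodes of $T_i$, and $P(T_0\mid T_i)=1-P(T_1\mid T_i)$. Let $P(T_0),P(T_1)$ be the stationary probabilities and $L_{T_i}$ the expected codeword length in $T_i$ under the source distribution. The average code length is $L_{\rm AIFV}=P(T_0)L_{T_0}+P(T_1)L_{T_1}$. Let $L_{\rm OPT}$ be the minimum of $L_{\rm AIFV}$ over all binary AIFV codes for the given source. The redundancy of the optimal binary AIFV code for the source is $r_{\rm AIFV}=L_{\rm OPT}-H(X)$. *)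

(* Defs.v *)
From HB Require Import structures.
From mathcomp Require Import all_boot all_order all_algebra.
From mathcomp Require Import all_classical all_reals all_analysis.
From mathcomp Require Import ring lra.

Set Implicit Arguments.
Unset Strict Implicit.
Unset Printing Implicit Defensive.

Import Order.TTheory GRing.Theory Num.Theory.
Local Open Scope classical_set_scope.
Local Open Scope ring_scope.

Record source (R : realType) := Source {
  alphabet : finType;
  prob : alphabet -> R;
  alphabet_ge2 : (2 <= #|alphabet|)%N;
  prob_gt0 : forall x, 0 < prob x;
  prob_sum1 : \sum_x prob x = 1 }.

(* Probabilities are positive, so 0 is a neutral starting value for the max. *)
Definition pmax (R : realType) (S : source R) : R :=
  \big[Num.max/0]_(x : alphabet S) prob x.

Definition log2 (R : realType) (x : R) : R := ln x / ln 2.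

Definition entropy (R : realType) (S : source R) : R :=
  - \sum_(x : alphabet S) prob x * log2 (prob x).

Definition binary_entropy (R : realType) (x : R) : R :=
  - x * log2 x - (1 - x) * log2 (1 - x).

(* A binary code tree whose incomplete internal nodes are split into master and
   slave nodes, with symbols on exactly the leaves and the master nodes.  The
   boolean argument is the label of the edge to the only child of an incomplete
   node (false is the code symbol 0, true is 1); [Complete] takes the child
   along 0 first. *)
Inductive code_tree (X : Type) : Type :=
| Leaf of X
| Complete of code_tree X & code_tree X
| Master of X & bool & code_tree X
| Slave of bool & code_tree X.

(* One entry [(x, w, m)] per symbol-bearing node: its symbol, the labels on the
   path from the root, and whether the node is a master node. *)
Fixpoint codebook (X : Type) (t : code_tree X) : seq (X * seq bool * bool) :=
  let under b s := [seq (e.1.1, b :: e.1.2, e.2) | e <- s] in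
  match t with
  | Leaf x => [:: (x, [::], false)]
  | Complete l r => under false (codebook l) ++ under true (codebook r)
  | Master x b s => (x, [::], true) :: under b (codebook s)
  | Slave b s => under b (codebook s)
  end.

Definition bijective_assignment (X : finType) (t : code_tree X) : bool :=
  perm_eq [seq e.1.1 | e <- codebook t] (enum X).

Fixpoint masters_ok (X : Type) (t : code_tree X) : bool :=
  match t with
  | Leaf _ => true
  | Complete l r => masters_ok l && masters_ok r
  | Master _ b s =>
      [&& ~~ b, (if s is Slave b' _ then ~~ b' else false) & masters_ok s]
  | Slave _ s => masters_ok s
  end.

Definition T1_root_ok (X : Type) (t : code_tree X) : bool :=
  if t is Complete (Slave b _) _ then b else false.

Definition is_AIFV (X : finType) (T0 T1 : code_tree X) : bool :=
  [&& bijective_assignment T0, masters_ok T0,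
      bijective_assignment T1, masters_ok T1 & T1_root_ok T1].

Definition tree_length (R : realType) (S : source R)
    (t : code_tree (alphabet S)) : R :=
  \sum_(e <- codebook t) prob e.1.1 * (size e.1.2)%:R.

(* The transition probability P(T_1 | t). *)
Definition master_prob (R : realType) (S : source R)
    (t : code_tree (alphabet S)) : R :=
  \sum_(e <- codebook t | e.2) prob e.1.1.

(* [(pi0, pi1)] is a stationary distribution of the two-state chain with
   P(T_1 | T_i) = qi. *)
Definition stationary (R : realType) (q0 q1 pi0 pi1 : R) : Prop :=
  [/\ 0 <= pi0, 0 <= pi1, pi0 + pi1 = 1,
      pi0 * (1 - q0) + pi1 * (1 - q1) = pi0
    & pi0 * q0 + pi1 * q1 = pi1].

(* The stationary distribution is unique, see [stationaryE]. *)
Definition average_length (R : realType) (S : source R)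
    (T0 T1 : code_tree (alphabet S)) (L : R) : Prop :=
  exists pi0 pi1 : R,
    stationary (master_prob T0) (master_prob T1) pi0 pi1 /\
    L = pi0 * tree_length T0 + pi1 * tree_length T1.

Definition AIFV_lengths (R : realType) (S : source R) : set R :=
  [set L | exists T0 T1 : code_tree (alphabet S),
     is_AIFV T0 T1 /\ average_length T0 T1 L].

Definition is_minimum (R : realType) (A : set R) (m : R) : Prop :=
  A m /\ lbound A m.

Lemma stationaryE (R : realType) (q0 q1 pi0 pi1 : R) : 0 <= q0 -> q1 < 1 ->
  stationary q0 q1 pi0 pi1 <->
  pi0 = (1 - q1) / (1 - q1 + q0) /\ pi1 = q0 / (1 - q1 + q0).
Proof.
move=> q0_ge0 q1_lt1; have D : 1 - q1 + q0 != 0 by apply/lt0r_neq0; lra.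
split=> [[_ _ E1 _ E2]|[-> ->]].
  have E0 : pi0 = 1 - pi1 by lra.
  subst pi0.
  have E : pi1 * (1 - q1 + q0) = q0 by lra.
  by split; apply: (mulIf D); rewrite divfK //; lra.
split; try (by apply: divr_ge0; lra).
all: by field.
Qed.

Section OptimumExists.
Variables (R : realType) (S : source R).
Notation X := (alphabet S).
Implicit Types (t : code_tree X).

Lemma big_codebook t (F : X -> R) : bijective_assignment t ->
  \sum_(e <- codebook t) F e.1.1 = \sum_x F x.
Proof.
move=> bt; rewrite -(big_map (fun e => e.1.1) xpredT F) /=.
by rewrite (perm_big _ bt) /= big_enum.
Qed.

Lemma nonmaster_in t : has (fun e => ~~ e.2) (codebook t).
Proof.
elim: t => //= [l IHl r _|x b s IHs|b s IHs].
- rewrite has_cat has_map; apply/orP; left.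
  by rewrite (eq_has (a2 := fun e => ~~ e.2)).
- by rewrite has_map (eq_has (a2 := fun e => ~~ e.2)).
- by rewrite has_map (eq_has (a2 := fun e => ~~ e.2)).
Qed.

Lemma min_prob : exists2 d : R, 0 < d & forall x : X, d <= prob x.
Proof.
have /card_gt0P[x0 _] : (0 < #|X|)%N by apply: leq_trans (alphabet_ge2 S).
exists (prob [arg min_(x < x0) prob x]%O); first exact: prob_gt0.
by move=> x; case: arg_minP => // y _; exact.
Qed.

Lemma master_prob_ge0 t : 0 <= master_prob t.
Proof. by apply: sumr_ge0 => e _; apply: ltW; apply: prob_gt0. Qed.

Lemma master_prob_le t (d : R) : (forall x : X, d <= prob x) ->
  bijective_assignment t -> master_prob t <= 1 - d.
Proof.
move=> dP bt; rewrite -(prob_sum1 S) -(big_codebook _ bt).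
rewrite (bigID (fun e : X * seq bool * bool => e.2)) /= -/(master_prob t).
rewrite -addrA lerDl subr_ge0.
have /hasP[e et ne] := nonmaster_in t.
rewrite (big_rem e) //= ne; apply: le_trans (dP e.1.1) _; rewrite lerDl.
by apply: sumr_ge0 => ? _; apply: ltW; apply: prob_gt0.
Qed.

Lemma tree_length_ge0 t : 0 <= tree_length t.
Proof.
apply: sumr_ge0 => e _; apply: mulr_ge0; last exact: ler0n.
by apply: ltW; apply: prob_gt0.
Qed.

Definition AIFV_length (l0 q0 l1 q1 : R) : R :=
  (1 - q1) / (1 - q1 + q0) * l0 + q0 / (1 - q1 + q0) * l1.

Lemma average_lengthE (T0 T1 : code_tree X) L : is_AIFV T0 T1 ->
  average_length T0 T1 L <->
  L = AIFV_length (tree_length T0) (master_prob T0)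
                  (tree_length T1) (master_prob T1).
Proof.
case/and5P=> _ _ b1 _ _; have [d d0 dP] := min_prob.
have q1 : master_prob T1 < 1 by have := master_prob_le dP b1; lra.
split=> [[pi0 [pi1 [st ->]]]|->].
  by have [-> ->] := (stationaryE pi0 pi1 (master_prob_ge0 T0) q1).1 st.
by do 2 eexists; split; [apply/(stationaryE _ _ (master_prob_ge0 T0) q1)|].
Qed.

Definition symbol_length t (x : X) : nat :=
  (\sum_(e <- codebook t | x == e.1.1) size e.1.2)%N.
Definition symbol_master t (x : X) : nat :=
  (\sum_(e <- codebook t | x == e.1.1) e.2)%N.

Lemma sum_by_symbol t (g : X * seq bool * bool -> nat) :
  \sum_(e <- codebook t) prob e.1.1 * (g e)%:R =
  \sum_(x : X) prob x * (\sum_(e <- codebook t | x == e.1.1) g e)%N%:R.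
Proof.
under [RHS]eq_bigr => x _ do rewrite natr_sum mulr_sumr big_mkcond /=.
rewrite exchange_big /=; apply: eq_bigr => e _.
by rewrite -big_mkcond /= big_pred1_eq.
Qed.

Lemma tree_lengthE t :
  tree_length t = \sum_(x : X) prob x * (symbol_length t x)%:R.
Proof. exact: sum_by_symbol. Qed.

Lemma master_probE t :
  master_prob t = \sum_(x : X) prob x * (symbol_master t x)%:R.
Proof.
rewrite -(sum_by_symbol t (fun e => e.2)) /master_prob big_mkcond.
by apply: eq_bigr => e _; case: e.2; rewrite ?mulr1 ?mulr0.
Qed.

Lemma symbol_length_le t (d : R) x : 0 < d -> (forall x : X, d <= prob x) ->
  (symbol_length t x)%:R <= tree_length t / d.
Proof.
move=> d0 dP; rewrite ler_pdivlMr // tree_lengthE (bigD1 x) //= mulrC.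
apply: (@le_trans _ _ (prob x * (symbol_length t x)%:R)).
  by apply: ler_wpM2r; rewrite ?ler0n.
rewrite lerDl; apply: sumr_ge0 => y _; apply: mulr_ge0; last exact: ler0n.
by apply: ltW; apply: prob_gt0.
Qed.

Lemma symbol_master_le t x : bijective_assignment t ->
  (symbol_master t x <= #|X|)%N.
Proof.
move=> bt; rewrite cardE -(perm_size bt) size_map -sum1_size.
rewrite /symbol_master big_mkcond /=; apply: leq_sum => e _.
by case: ifP => // _; case: e.2.
Qed.

Fixpoint comb (x : X) (s : seq X) : code_tree X :=
  if s is y :: s' then Complete (Leaf x) (comb y s') else Leaf x.

Lemma combP x s :
  [seq e.1.1 | e <- codebook (comb x s)] = x :: s /\ masters_ok (comb x s).
Proof.
elim: s x => //= y s IH x; have [E ->] := IH y; split=> //.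
by congr cons; rewrite -map_comp -E; apply: eq_map.
Qed.

Lemma AIFV_exists : exists T0 T1 : code_tree X, is_AIFV T0 T1.
Proof.
have := alphabet_ge2 S; rewrite cardE.
case E : (enum X) => [|x [|y s]] // _.
exists (comb x (y :: s)), (Complete (Slave true (comb y s)) (Leaf x)).
have [E1 m1] := combP x (y :: s); have [E2 m2] := combP y s.
rewrite /is_AIFV m1 /= m2 /= /bijective_assignment E1 E perm_refl /=.
rewrite map_cat -!map_comp /=.
under eq_map => e do rewrite /=.
by rewrite E2 andbT perm_catC perm_refl.
Qed.

(* A code is described, up to its average length, by the length and the
   master count of each symbol in both trees; those of a code of bounded
   average length range over a finite set, once an unused T_1 is replaced by a
   fixed one. *)
Lemma minimum_exists : exists L, is_minimum (AIFV_lengths S) L.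
Proof.
have [d d0 dP] := min_prob.
have [U0 [U1 U]] := AIFV_exists.
pose V (T0 T1 : code_tree X) := AIFV_length (tree_length T0) (master_prob T0)
                                  (tree_length T1) (master_prob T1).
have AV (T0 T1 : code_tree X) : is_AIFV T0 T1 -> AIFV_lengths S (V T0 T1).
  by move=> c; exists T0, T1; split=> //; apply/average_lengthE.
have d1 : d <= 1.
  have /and5P[b0 _ _ _ _] := U.
  by have := master_prob_le dP b0; have := master_prob_ge0 U0; lra.
pose v := V U0 U1.
pose B := v / (d / 2 * d) / d + tree_length U1 / d + #|X|%:R.
pose N := Num.Def.truncn B.
pose D := ({ffun X -> 'I_N.+1} * {ffun X -> 'I_N.+1})%type.
pose l (a : D) : R := \sum_(x : X) prob x * (a.1 x : nat)%:R.
pose q (a : D) : R := \sum_(x : X) prob x * (a.2 x : nat)%:R.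
pose W (a : D * D) := AIFV_length (l a.1) (q a.1) (l a.2) (q a.2).
pose tr (t : code_tree X) : D :=
  ([ffun x => inord (symbol_length t x)], [ffun x => inord (symbol_master t x)]).
have v0 : 0 <= v.
  have /and5P[b0 _ b1 _ _] := U.
  have := master_prob_le dP b1; have := master_prob_ge0 U0.
  move=> q0 q1; rewrite /v /V /AIFV_length.
  by apply: addr_ge0; apply: mulr_ge0; rewrite ?tree_length_ge0 //;
    apply: divr_ge0; lra.
have dd : 0 < d / 2 * d by apply: mulr_gt0 => //; lra.
have w0 : 0 <= v / (d / 2 * d) / d.
  by apply: divr_ge0; [exact: divr_ge0 v0 (ltW dd)|exact: ltW].
have u0 : 0 <= tree_length U1 / d by apply: divr_ge0; [exact: tree_length_ge0|lra].
have n0 : 0 <= (#|X|%:R : R) by exact: ler0n.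
have B0 : 0 <= B by rewrite /B; lra.
have leN k : k%:R <= B -> (k < N.+1)%N.
  by move=> kB; rewrite ltnS /N truncn_ge_nat.
have trE t : bijective_assignment t ->
    tree_length t <= Num.max (v / (d / 2 * d)) (tree_length U1) ->
    l (tr t) = tree_length t /\ q (tr t) = master_prob t.
  move=> bt lt; rewrite tree_lengthE master_probE; split; apply: eq_bigr => x _.
    rewrite ffunE inordK //; apply: leN.
    apply: le_trans (symbol_length_le t x d0 dP) _.
    have : tree_length t / d <=
        Num.max (v / (d / 2 * d)) (tree_length U1) / d.
      by rewrite ler_pM2r // invr_gt0.
    by rewrite /B; case: (leP (v / (d / 2 * d)) (tree_length U1)) => _ ?; lra.
  rewrite ffunE inordK //; apply: leN.
  apply: (@le_trans _ _ #|X|%:R); last by rewrite /B; lra.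
  by rewrite ler_nat symbol_master_le.
pose ach (a : D * D) := `[< AIFV_lengths S (W a) >].
have red (T0 T1 : code_tree X) : is_AIFV T0 T1 -> V T0 T1 <= v ->
    exists2 a, ach a & W a = V T0 T1.
  move=> c Vv; have /and5P[b0 m0 b1 m1 r1] := c.
  have q00 := master_prob_ge0 T0; have q10 := master_prob_ge0 T1.
  have q01 := master_prob_le dP b0; have q11 := master_prob_le dP b1.
  have l00 := tree_length_ge0 T0; have l10 := tree_length_ge0 T1.
  have Dp : 0 < 1 - master_prob T1 + master_prob T0 by lra.
  have P0 : d / 2 <= (1 - master_prob T1) / (1 - master_prob T1 + master_prob T0).
    rewrite ler_pdivlMr //.
    apply: (@le_trans _ _ (d / 2 * 2)); last by lra.
    by apply: ler_wpM2l; lra.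
  have P1 : 0 <= master_prob T0 / (1 - master_prob T1 + master_prob T0).
    by apply: divr_ge0 => //; lra.
  have lT0 : tree_length T0 <= v / (d / 2 * d).
    rewrite ler_pdivlMr //; apply: le_trans Vv; rewrite /V /AIFV_length.
    set p0 := ((1 - _) / _) in P0 *; set p1 := (master_prob T0 / _) in P1 *.
    have h1 : tree_length T0 * (d / 2 * d) <= tree_length T0 * p0.
      apply: ler_wpM2l => //.
      have h : d / 2 * d <= d / 2 * 1 by apply: ler_wpM2l; lra.
      lra.
    have h2 : 0 <= p1 * tree_length T1 by apply: mulr_ge0.
    lra.
  have [lt0 qt0] : l (tr T0) = tree_length T0 /\ q (tr T0) = master_prob T0.
    by apply: trE => //; rewrite le_max lT0.
  have [q0|q0] := eqVneq (master_prob T0) 0.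
    have /and5P[_ _ bu mu ru] := U.
    have [ltu qtu] : l (tr U1) = tree_length U1 /\ q (tr U1) = master_prob U1.
      by apply: trE => //; rewrite le_max lexx orbT.
    have WE : W (tr T0, tr U1) = V T0 U1 by rewrite /W /= lt0 qt0 ltu qtu.
    exists (tr T0, tr U1).
      by apply/asboolP; rewrite WE; apply: AV; apply/and5P; split.
    rewrite WE /V /AIFV_length q0 !addr0 !mul0r !addr0 !divff //.
      by apply/lt0r_neq0; lra.
    by apply/lt0r_neq0; have := master_prob_le dP bu; lra.
  have q0d : d <= master_prob T0.
    have : has (fun e : X * seq bool * bool => e.2) (codebook T0).
      apply: contra_neqT q0 => /hasPn h; rewrite /master_prob big_seq_cond.
      by apply: big1 => e /andP[/h /negbTE ->].
    case/hasP=> e et e2; rewrite /master_prob (big_rem e) //= e2.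
    apply: le_trans (dP e.1.1) _; rewrite lerDl.
    by apply: sumr_ge0 => ? _; apply: ltW; apply: prob_gt0.
  have P1' : d / 2 * d <= master_prob T0 / (1 - master_prob T1 + master_prob T0).
    rewrite ler_pdivlMr //.
    apply: (@le_trans _ _ (d / 2 * d * 2)); first by apply: ler_wpM2l; lra.
    have h : d * d <= d * 1 by apply: ler_wpM2l; lra.
    lra.
  have lT1 : tree_length T1 <= v / (d / 2 * d).
    rewrite ler_pdivlMr //; apply: le_trans Vv; rewrite /V /AIFV_length.
    set p0 := ((1 - _) / _) in P0 *; set p1 := (master_prob T0 / _) in P1' *.
    have h1 : tree_length T1 * (d / 2 * d) <= tree_length T1 * p1.
      by apply: ler_wpM2l.
    have h2 : 0 <= p0 * tree_length T0 by apply: mulr_ge0 => //; lra.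
    lra.
  have [lt1 qt1] : l (tr T1) = tree_length T1 /\ q (tr T1) = master_prob T1.
    by apply: trE => //; rewrite le_max lT1.
  have WE : W (tr T0, tr T1) = V T0 T1 by rewrite /W /= lt0 qt0 lt1 qt1.
  by exists (tr T0, tr T1) => //; apply/asboolP; rewrite WE; apply: AV.
have [a0 a0P a0E] := red _ _ U (lexx v).
pose a := [arg min_(a < a0 | ach a) W a]%O.
have [aP amin] : ach a /\ forall b, ach b -> W a <= W b.
  by rewrite /a; case: arg_minP.
exists (W a); split; first exact/asboolP.
move=> L [T0 [T1 [c /(average_lengthE _ c) E]]]; rewrite {}E -/(V T0 T1).
have [Vv|/ltW vV] := leP (V T0 T1) v.
  by have [b bP <-] := red _ _ c Vv; apply: amin.
by apply: le_trans vV; rewrite /v -a0E; apply: amin.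
Qed.

End OptimumExists.

Definition optimal_length (R : realType) (S : source R) : R :=
  sval (cid (minimum_exists S)).

Definition redundancy (R : realType) (S : source R) : R :=
  optimal_length S - entropy S.

Definition worst_case_redundancy (R : realType) (p : R) : \bar R :=
  ereal_sup [set r | exists2 S : source R, pmax S = p & (redundancy S)%:E = r].

Definition f (R : realType) (x : R) : R :=
  if x <= (-1 + Num.sqrt 5) / 2 then x ^+ 2 - 2 * x + 2 - binary_entropy x
  else (- 2 * x ^+ 2 + x + 2) / (1 + x) - binary_entropy x.

(* Main.v *)
Require Import Defs.
From mathcomp Require Import all_boot all_order all_algebra.
From mathcomp Require Import all_classical all_reals all_analysis.
From mathcomp Require Import ring lra.

(* Upper bound.  Let [a] be the most likely symbol, p its probability and
   w = 1 - p.  Take a tree t for the other symbols, let T_1 have the leaf [a]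
   along 1 and t below 01, and let T_0 be either the complete node with children
   [a] and t or the master node [a] with t below 00.  Writing l and q for the
   (unnormalised) length and master probability of t, and e for the excess of l
   over the entropy of the other symbols, the first choice of T_0 has redundancy
   at most f(p) as soon as e <= w (w - q), the second one as soon as
   e <= p / (1 + p) (w - q).  On either side of the golden ratio point the
   factor involved is at least (3 - sqrt 5) / 2 > 19/50, so it is enough to find
   t with e <= 19/50 (w - q), for an arbitrary distribution.  Such a tree is
   built from the root: a dominant symbol becomes a master node, a moderately
   likely one a leaf below a complete node, and otherwise the symbols are divided
   into two sets of weights as equal as possible.

   Lower bound.  Take the probabilities p, 1 - p - eps, eps.  By linear
   programming duality for the two-state chain, L >= g as soon as
   L_T0 + c q_0 >= g and L_T1 + c q_1 >= g + c for some multiplier c; the right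
   choices are c = 1 - p and c = p / (1 + p), and the two inequalities are
   checked on all trees with three symbols. *)

Set Implicit Arguments.
Unset Strict Implicit.
Unset Printing Implicit Defensive.

Import Order.TTheory GRing.Theory Num.Theory.
Import numFieldNormedType.Exports.
Local Open Scope ring_scope.

(** * Numerical bounds on logarithms and on the entropy of a binary split *)

Section RealInequalities.
Local Open Scope classical_set_scope.
Local Open Scope ring_scope.
Variable R : realType.
Implicit Types u x y s : R.

Lemma le_lnB1 x : 0 < x -> ln x <= x - 1.
Proof.
move=> x0; have -> : ln x = ln (1 + (x - 1)) by congr ln; ring.
by apply: le_ln1Dx; lra.
Qed.

(** The right side is the Taylor polynomial of [ln] at 1. Its difference with [ln] has derivative (y
    - 1)^3 / y, hence is least at 1, where it vanishes. *)
Lemma ln_le_cubic x : 0 < x ->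
  ln x <= (x - 1) - (x - 1) ^+ 2 / 2 + (x - 1) ^+ 3 / 3.
Proof.
move=> x0; rewrite -subr_ge0.
pose P : {poly R} := 3^-1 *: 'X^3 - (3 / 2) *: 'X^2 + 3 *: 'X.
pose g (y : R) : R := P.[y] - ln y.
have gd (y : R) : 0 < y -> is_derive y (1 : R) g ((y - 1) ^+ 3 / y).
  move=> y0; have dl := is_derive1_ln y0.
  have dP : is_derive y (1:R) (horner P) (P^`()).[y] by apply: is_derive_poly.
  apply: is_derive_eq (is_deriveB dP dl) _.
  rewrite /P !(derivD, derivN, derivZ, derivXn, derivX).
  rewrite !(hornerD, hornerN, hornerZ, hornerMn, hornerXn, hornerC) /=.
  by field; lra.
have gx : g x - g 1 = (x - 1) - (x - 1) ^+ 2 / 2 + (x - 1) ^+ 3 / 3 - ln x.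
  by rewrite /g ln1 /P !(hornerD, hornerN, hornerZ, hornerXn, hornerX); field.
have mvt (a b : R) : 0 < a -> a <= b ->
    exists2 c, a <= c <= b & g b - g a = (c - 1) ^+ 3 / c * (b - a).
  move=> a0 ab; have [z||c cab E] := @MVT_segment R g (fun c => (c - 1) ^+ 3 / c) a b ab.
  - by rewrite in_itv /= => /andP[az _]; apply: gd; lra.
  - apply: derivable_within_continuous => z; rewrite in_itv /= => /andP[az _].
    by have [] := gd z (lt_le_trans a0 az).
  - by exists c; rewrite // -in_itv.
rewrite -gx.
have [x1|x1] := leP 1 x.
  have [//|c /andP[c1 _] ->] := mvt 1 x ltr01.
  by apply: mulr_ge0; [apply: divr_ge0; [apply: exprn_ge0|]|]; lra.
have [c /andP[c1 c2] E] := mvt x 1 x0 (ltW x1).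
have h : 0 <= (1 - c) ^+ 3 / c * (1 - x).
  by apply: mulr_ge0; [apply: divr_ge0; [apply: exprn_ge0|]|]; lra.
have -> : g x - g 1 = - (g 1 - g x) by ring.
rewrite E; move: h; by congr (_ <= _); field; lra.
Qed.

(** Upper bounds on logarithms bound [ln 2] from below through 1/2 = 3/4 * 2/3, with factors close
    to 1. *)
Lemma ln2_ge : 6836 / 10000 <= ln 2 :> R.
Proof.
have h1 := ln_le_cubic (_ : 0 < 3 / 4); have h2 := ln_le_cubic (_ : 0 < 2 / 3).
have E : ln 2 = - (ln (3 / 4) + ln (2 / 3)) :> R.
  rewrite -lnM ?posrE; [|lra..]; rewrite -lnV ?posrE; last lra.
  by congr ln; field.
rewrite E; have := h1 ltac:(lra); have := h2 ltac:(lra); lra.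
Qed.

Lemma ln2_le : ln 2 <= 7 / 10 :> R.
Proof.
have h1 := ln_le_cubic (_ : 0 < 5 / 4); have h2 := ln_le_cubic (_ : 0 < 4 / 3).
have h3 := ln_le_cubic (_ : 0 < 6 / 5).
have E : ln 2 = ln (5 / 4) + (ln (4 / 3) + ln (6 / 5)) :> R.
  rewrite -!lnM ?posrE; [|lra..].
  by congr ln; field.
rewrite E; have := h1 ltac:(lra); have := h2 ltac:(lra); have := h3 ltac:(lra); lra.
Qed.

Lemma sqrt5_bounds : 223 / 100 <= Num.sqrt (5 : R) <= 224 / 100.
Proof.
have s0 : 0 <= Num.sqrt 5 :> R by apply: sqrtr_ge0.
have s2 : Num.sqrt 5 ^+ 2 = 5 :> R by rewrite sqr_sqrtr.
by apply/andP; split; rewrite leNgt; apply/negP => h; nra.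
Qed.

Definition eta x : R := - (x * log2 x).
(* [x + y] times the binary entropy of [x / (x + y)]. *)
Definition hsplit x y : R := eta x + eta y - eta (x + y).

Lemma ln2_gt0 : 0 < ln 2 :> R.
Proof. by apply: lt_le_trans ln2_ge; lra. Qed.

Lemma hsplitE x y : 0 < x -> 0 < y ->
  hsplit x y = (- x * ln (x / (x + y)) - y * ln (y / (x + y))) / ln 2.
Proof.
move=> x0 y0; rewrite /hsplit /eta /log2 !ln_div ?posrE ?addr_gt0 //.
by field; rewrite gt_eqF // ln2_gt0.
Qed.

Lemma hsplitZ s x y : 0 < s -> 0 < x -> 0 < y ->
  hsplit (s * x) (s * y) = s * hsplit x y.
Proof.
move=> s0 x0 y0; have sN0 := lt0r_neq0 s0; rewrite !hsplitE ?mulr_gt0 // -mulrDr.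
by rewrite -!mulf_div divff // !mul1r; ring.
Qed.

Lemma hsplit_scale x y : 0 < x -> 0 < y ->
  hsplit x y = (x + y) * hsplit (x / (x + y)) (y / (x + y)).
Proof.
move=> x0 y0; have s0 : 0 < x + y by apply: addr_gt0.
rewrite -hsplitZ ?divr_gt0 // mulrC divfK ?gt_eqF // mulrC divfK ?gt_eqF //.
Qed.

(** Divided by 2 [ln 2], the left side is the deficit 1 - h((1 + u) / 2) of a split with relative
    imbalance u. *)
Lemma ln1DB_le_quadratic u : - (3 / 8) <= u <= 3 / 8 ->
  (1 + u) * ln (1 + u) + (1 - u) * ln (1 - u) <= 8 / 5 * u ^+ 2 * ln 2.
Proof.
move=> /andP[u1 u2]; have p1 : 0 < 1 + u by lra.
have p2 : 0 < 1 - u by lra.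
have h1 := ler_wpM2l (ltW p1) (ln_le_cubic p1).
have h2 := ler_wpM2l (ltW p2) (ln_le_cubic p2).
apply: le_trans (lerD h1 h2) _.
have uu : u ^+ 2 <= 9 / 64.
  have := mulr_ge0 (_ : 0 <= 3 / 8 - u) (_ : 0 <= 3 / 8 + u); clear -u1 u2.
  by move=> /(_ ltac:(lra) ltac:(lra)); lra.
have u4 := ler_wpM2r (sqr_ge0 u) uu.
have k := ler_wpM2l (sqr_ge0 u) ln2_ge.
(* The sum is at most (1 + 3/32) u^2, and 1.09375 is just below 8/5 of the lower bound 0.6836 for
   [ln 2]. *)
have -> : (1 + u) * (1 + u - 1 - (1 + u - 1) ^+ 2 / 2 + (1 + u - 1) ^+ 3 / 3) +
  (1 - u) * (1 - u - 1 - (1 - u - 1) ^+ 2 / 2 + (1 - u - 1) ^+ 3 / 3) =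
  u ^+ 2 + 2 / 3 * (u ^+ 2 * u ^+ 2) by field.
have := sqr_ge0 u; move: k u4; clear.
move: (u ^+ 2) (ln 2) => a b; lra.
Qed.

Lemma hsplit_ge_quadratic x y : 0 < x -> 0 < y ->
  `|x - y| <= 3 / 8 * (x + y) ->
  (x + y) - 4 / 5 * (x - y) ^+ 2 / (x + y) <= hsplit x y.
Proof.
move=> x0 y0; have s0 : 0 < x + y by rewrite addr_gt0.
move=> d.
have ub : - (3 / 8) <= (x - y) / (x + y) <= 3 / 8.
  by rewrite -ler_norml normrM normfV (gtr0_norm s0) ler_pdivrMr.
have h := ln1DB_le_quadratic ub.
rewrite hsplitE // ler_pdivlMr ?ln2_gt0 //.
have sN0 : x + y != 0 by rewrite gt_eqF.
have -> : x / (x + y) = (1 + (x - y) / (x + y)) / 2 by field.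
have -> : y / (x + y) = (1 - (x - y) / (x + y)) / 2 by field.
move: h ub.
have := mulrC (x + y) ((x - y) / (x + y)); rewrite divfK //.
move: ((x - y) / (x + y)) => u xyE h /andP[u1 u2].
rewrite !ln_div ?posrE //; [|by lra..].
have -> : 4 / 5 * (x - y) ^+ 2 / (x + y) = (x + y) * (4 / 5 * u ^+ 2).
  by rewrite -xyE; field.
have -> : - x * (ln (1 + u) - ln 2) - y * (ln (1 - u) - ln 2) =
   (x + y) * (ln 2 - ((1 + u) * ln (1 + u) + (1 - u) * ln (1 - u)) / 2).
  have hx : x = ((x + y) + (x + y) * u) / 2 by rewrite xyE; field.
  have hy : y = ((x + y) - (x + y) * u) / 2 by rewrite xyE; field.
  by move: hx hy; move: (x + y) => s -> ->; field.
have -> : (x + y - (x + y) * (4 / 5 * u ^+ 2)) * ln 2 =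
  (x + y) * (ln 2 - 4 / 5 * u ^+ 2 * ln 2) by ring.
apply: ler_wpM2l; first exact: ltW.
move: h; clear; move: (_ * ln (1 + u) + _) => F; move: (u ^+ 2) (ln 2) => a b; lra.
Qed.

(** The term 2 y is the price of the two edges below a master node, the minimum is the slack of
    [good_tree]. *)
Lemma hsplit_ge_min x y : 0 < x -> 0 < y -> y <= 5 / 16 * (x + y) ->
  2 * y + 1 / 5 * Num.min x (5 * y) <= hsplit x y.
Proof.
move=> x0 y0; have s0 : 0 < x + y by rewrite addr_gt0.
rewrite -ler_pdivrMr //.
have sN0 : x + y != 0 by rewrite gt_eqF.
rewrite hsplit_scale //.
have -> : 2 * y + 1 / 5 * Num.min x (5 * y) =
  (x + y) * (2 * (y / (x + y)) + 1 / 5 * Num.min (x / (x + y)) (5 * (y / (x + y)))).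
  have -> : Num.min x (5 * y) = (x + y) * Num.min (x / (x + y)) (5 * (y / (x + y))).
    by rewrite minr_pMr ?ltW //; congr Num.min; field.
  by field.
move=> w1; apply: ler_wpM2l; first exact: ltW.
have -> : x / (x + y) = 1 - y / (x + y) by field.
have w0 : 0 < y / (x + y) by rewrite divr_gt0.
move: (y / (x + y)) w0 w1 => w w0 w1 {x y x0 y0 s0 sN0}.
have v0 : 0 < 1 - w by lra.
rewrite hsplitE // subrK !divr1 ler_pdivlMr ?ln2_gt0 //.
have h1 := ler_wpM2l (ltW v0) (le_lnB1 v0).
(* Linearising [ln] at w = 1/4 yields the main term 2 w [ln 2]; with the bound on [ln (1 - w)], a
   surplus w (2 - 5 w) remains for the minimum. *)
have w40 : 0 < 4 * w by lra.
have h2 := ler_wpM2l (ltW w0) (le_lnB1 w40).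
have E : ln (4 * w) = 2 * ln 2 + ln w.
  rewrite lnM ?posrE //; have -> : 4 = 2 * 2 :> R by ring.
  by rewrite lnM ?posrE //; ring.
rewrite E in h2.
set a := Num.min _ _.
have a1 : a <= 1 - w by rewrite ge_min lexx.
have a2 : a <= 5 * w by rewrite ge_min lexx orbT.
have a0 : 0 <= a by rewrite le_min ltW //=; lra.
have h3 := ler_wpM2l a0 ln2_le.
suff : 1 / 5 * (a * (7 / 10)) <= w * (2 - 5 * w).
  move: h1 h2 h3; clear; move: (ln 2) (ln w) (ln (1 - w)) => l l1 l2; nra.
move: w0 w1 a1 a2; clear; move: a => a w0 w1 a1 a2.
have [w4|w4] := leP w (1 / 4); nra.
Qed.

End RealInequalities.

(** * Splitting a weighted set into two nearly equal parts *)

Section BalancedSplit.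
Import mathcomp.boot.fintype mathcomp.boot.finset.
Variables (R : realType) (X : finType) (w : X -> R).
Hypothesis w_gt0 : forall x, 0 < w x.
Implicit Types (A D H L : {set X}).

Definition weight A : R := \sum_(x in A) w x.

Lemma weight_ge0 A : 0 <= weight A.
Proof. by apply: sumr_ge0 => x _; apply: ltW. Qed.

Lemma weight_D1 A x : x \in A -> weight A = w x + weight (A :\ x).
Proof. by move=> xA; rewrite /weight (big_setD1 x). Qed.

Lemma weight_D A D : D \subset A -> weight A = weight D + weight (A :\: D).
Proof. by move=> DA; rewrite /weight (big_setID D) /= (setIidPr DA). Qed.

Lemma weight_U A D : [disjoint A & D] -> weight (A :|: D) = weight A + weight D.
Proof.
rewrite disjoint_sym => AD; rewrite (weight_D (subsetUl A D)) setDUl setDv set0U.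
by rewrite (setDidPl AD).
Qed.

Lemma weight_gt0 A x : x \in A -> 0 < weight A.
Proof. by move=> xA; rewrite (weight_D1 xA) ltr_pwDl ?weight_ge0. Qed.

Lemma weight_set0 : weight set0 = 0.
Proof. by rewrite /weight big_set0. Qed.

Lemma argmax A : A != set0 ->
  exists2 a, a \in A & forall x, x \in A -> w x <= w a.
Proof.
case/set0Pn=> x0 x0A; exists [arg max_(x > x0 in A) w x]%O.
  by case: arg_maxP.
by move=> x xA; case: arg_maxP => // a _ /(_ x xA).
Qed.

(* [H] has least weight among the subsets of [A] of weight at least half: no
   subset of [A] then weighs strictly between [A :\: H] and [H]. *)
Lemma exists_tight_split A : exists2 H : {set X}, H \subset A &
  weight (A :\: H) <= weight H /\
  forall D : {set X}, D \subset A -> weight D < weight H -> weight D <= weight (A :\: H).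
Proof.
pose P (D : {set X}) := (D \subset A) && (weight (A :\: D) <= weight D).
have PA : P A by rewrite /P subxx setDv weight_set0 weight_ge0.
exists [arg min_(D < A | P D) weight D]%O; case: arg_minP => // H /andP[HA hH] mH //.
split=> // D DA DH; rewrite leNgt; apply/negP => LD.
have EH := weight_D HA; have ED := weight_D DA.
have sub : A :\: D \subset A by apply: subsetDl.
have AAD : weight (A :\: (A :\: D)) = weight D by rewrite setDDr setDv set0U (setIidPr DA).
(* [D] and its complement both weigh less than [H], and one of them at least half of [A], against
   the minimality of [H]. *)
have [le1|le1] := leP (weight (A :\: D)) (weight D).
  by have := mH D; rewrite /P DA le1 => /(_ isT); move=> *; lra.
have := mH (A :\: D); rewrite /P sub AAD ltW // => /(_ isT); move=> *; lra.
Qed.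

(* A large [y] exists because otherwise the weights of the subsets of [L] would
   grow in steps smaller than the gap [weight H - weight L], and exchanging one
   of them with an element of [H] would give a weight inside the gap. *)
Lemma balanced_split A :
  A != set0 -> (forall x, x \in A -> w x < weight A / 2) ->
  exists H L, [/\ H :|: L = A, [disjoint H & L], weight L <= weight H,
    forall z, z \in H -> weight H - weight L <= w z &
    exists2 y, y \in L & weight H - weight L <= w y].
Proof.
move=> A0 small; have [H HA [LH gap]] := exists_tight_split A.
have EA := weight_D HA; have [x0 x0A] := set0Pn _ A0.
have A_gt0 := weight_gt0 x0A.
exists H, (A :\: H); split=> //.
- by apply/setP=> x; rewrite !inE; case: (boolP (x \in H)) => //= /(subsetP HA) ->.
- by rewrite disjoints_subset; apply/subsetP=> x xH; rewrite !inE xH.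
- move=> z zH; have EH := weight_D1 zH; have := gap (H :\ z).
  rewrite (subset_trans (subsetDl _ _) HA) => /(_ isT); have := w_gt0 z; move: EH.
  move: (weight _) (weight _) (weight _) (w z) => a b c d *; lra.
have [z zH] : exists z, z \in H.
  apply/set0Pn; apply/eqP => H0; move: LH EA; rewrite H0 weight_set0 setD0; move=> *; lra.
have EH := weight_D1 zH; have zA := subsetP HA z zH; have zs := small z zA.
pose d := weight H - weight (A :\: H).
pose P (D : {set X}) := (D \subset A :\: H) && (weight D <= w z - d).
have dz : d <= w z.
  have := gap (H :\ z); rewrite (subset_trans (subsetDl _ _) HA) => /(_ isT).
  have := w_gt0 z; rewrite /d; move: EH.
  move: (weight _) (weight _) (weight _) (w z) => a b c e *; lra.
have P0 : P set0 by rewrite /P sub0set weight_set0 subr_ge0.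
case: (@arg_maxP _ _ _ set0 P weight P0) => Y /andP[YL hY] maxY.
(* If [Y] were all of [A :\: H], then [z] alone would weigh at least [weight H], hence half of
   [A]. *)
have [E|] := eqVneq (A :\: H) Y.
  suff : w z < w z by rewrite ltxx.
  by move: hY EA LH zs; rewrite -E /d; move: (weight _) (weight _) (weight _) => a b c *; lra.
move=> nE; have : ~~ (A :\: H \subset Y) by apply: contra nE => ?; rewrite eqEsubset YL andbT.
case/subsetPn=> y yL yY; exists y => //; rewrite -/d leNgt; apply/negP=> yd.
have yYL : y |: Y \subset A :\: H by rewrite subUset sub1set yL YL.
have EY : weight (y |: Y) = w y + weight Y by rewrite /weight big_setU1.
have Ybig : w z - d < weight (y |: Y).
  rewrite ltNge; apply/negP => h; have := maxY (y |: Y); rewrite /P yYL h => /(_ isT) /=.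
  by rewrite EY gerDr leNgt w_gt0.
have disj : [disjoint H :\ z & y |: Y].
  rewrite disjoints_subset; apply/subsetP=> x; rewrite !inE => /andP[_ xH].
  by rewrite -in_setU1; apply: contraTN xH => /(subsetP yYL); rewrite inE => /andP[].
have sub : (H :\ z) :|: (y |: Y) \subset A.
  by rewrite subUset (subset_trans (subsetDl _ _) HA) (subset_trans yYL (subsetDl _ _)).
have := gap _ sub; rewrite weight_U //; move: EY Ybig yd hY EH; rewrite /d.
move: (weight _) (weight _) (weight _) (weight _) (weight _) => a b c e g.
move=> ? ? ? ? ? /(_ ltac:(lra)); move=> *; lra.
Qed.

(* Every element of [H] weighs at least the gap, so three of them would be too
   heavy. *)
Lemma heavy_side_le A H L a b : H :|: L = A -> [disjoint H & L] ->
  (forall z, z \in H -> weight H - weight L <= w z) ->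
  weight A < 5 * (weight H - weight L) ->
  a \in A -> (forall x, x \in A -> w x <= w a) ->
  (forall x, x \in A :\ a -> w x <= w b) ->
  weight H <= w a + w b.
Proof.
move=> EA dHL Hd big aA maxa maxb.
have EW : weight A = weight H + weight L by rewrite -EA weight_U.
have HA : H \subset A by rewrite -EA subsetUl.
(* Choosing [z1 = a] when possible makes any second element differ from [a], hence weigh at most
   [w b]. *)
have two z1 : z1 \in H -> (z1 = a \/ a \notin H) -> weight H <= w a + w b.
  move=> z1H cond; rewrite (weight_D1 z1H); apply: lerD.
    exact/maxa/(subsetP HA).
  have [->|/set0Pn[z2 z2H]] := eqVneq (H :\ z1) set0.
    rewrite weight_set0 ltW //; exact: w_gt0.
  have := z2H; rewrite !inE => /andP[z21 z2H'].
  have z2a : z2 \in A :\ a.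
    rewrite !inE (subsetP HA _ z2H') andbT.
    by case: cond => [<- //|]; apply: contra => /eqP <-.
  rewrite (weight_D1 z2H); have [->|/set0Pn[z3 z3H]] := eqVneq ((H :\ z1) :\ z2) set0.
    by rewrite weight_set0 addr0 maxb.
  (* Three elements give [weight H] at least three gaps, so [weight L] at least two, against
     [big]. *)
  have := weight_D1 z3H; have := weight_ge0 (((H :\ z1) :\ z2) :\ z3).
  have := z3H; rewrite !inE => /and3P[_ _ /Hd].
  have := Hd _ z2H'; have := Hd _ z1H.
  have := weight_D1 z1H; have := weight_D1 z2H; move: big EW.
  by move: (weight _) (weight _) (weight _) (weight _) (weight _) (weight _) => p q r s t u *; lra.
have [aH|aH] := boolP (a \in H); first by apply: (two a) => //; left.
have [z zH] : exists z, z \in H.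
  apply/set0Pn; apply/eqP => H0; move: big EW; rewrite H0 weight_set0.
  by have := weight_ge0 L; have := ltxx (0 : R) => /negP h *; apply: h; lra.
by apply: (two z) => //; right.
Qed.

End BalancedSplit.

(** * Lengths, weights and master probabilities of composed trees *)

Section TreeSums.
Import Defs.
Variables (R : realType) (S : source R).
Notation X := (alphabet S).
Implicit Types (t l r : code_tree X).

Definition symbols t : seq X := [seq e.1.1 | e <- codebook t].
Definition tree_weight t : R := \sum_(x <- symbols t) prob x.

Lemma symbols_complete l r : symbols (Complete l r) = symbols l ++ symbols r.
Proof. by rewrite /symbols /= map_cat -!map_comp. Qed.

Lemma symbols_master x b t : symbols (Master x b t) = x :: symbols t.
Proof. by rewrite /symbols /= -map_comp. Qed.

Lemma symbols_slave b t : symbols (Slave b t) = symbols t.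
Proof. by rewrite /symbols /= -map_comp. Qed.

Lemma tree_weight_complete l r :
  tree_weight (Complete l r) = tree_weight l + tree_weight r.
Proof. by rewrite /tree_weight symbols_complete big_cat. Qed.

Lemma tree_weight_slave b t : tree_weight (Slave b t) = tree_weight t.
Proof. by rewrite /tree_weight symbols_slave. Qed.

Lemma tree_length_under b t :
  \sum_(e <- [seq (e.1.1, b :: e.1.2, e.2) | e <- codebook t])
    prob e.1.1 * (size e.1.2)%:R = tree_length t + tree_weight t.
Proof.
rewrite big_map /tree_weight big_map -big_split /=.
by apply: eq_bigr => e _; rewrite -natr1; ring.
Qed.

Lemma tree_length_leaf x : tree_length (Leaf x : code_tree X) = 0.
Proof. by rewrite /tree_length big_seq1 mulr0. Qed.

Lemma tree_length_complete l r : tree_length (Complete l r) =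
  tree_length l + tree_weight l + (tree_length r + tree_weight r).
Proof. by rewrite {1}/tree_length big_cat /= !tree_length_under. Qed.

Lemma tree_length_master x b t :
  tree_length (Master x b t) = tree_length t + tree_weight t.
Proof. by rewrite {1}/tree_length big_cons /= mulr0 add0r tree_length_under. Qed.

Lemma tree_length_slave b t :
  tree_length (Slave b t) = tree_length t + tree_weight t.
Proof. by rewrite {1}/tree_length tree_length_under. Qed.

Lemma master_prob_leaf x : master_prob (Leaf x : code_tree X) = 0.
Proof. by rewrite /master_prob big_cons /= big_nil. Qed.

Lemma master_prob_complete l r :
  master_prob (Complete l r) = master_prob l + master_prob r.
Proof. by rewrite /master_prob big_cat /= !big_map. Qed.

Lemma master_prob_master x b t :
  master_prob (Master x b t) = prob x + master_prob t.
Proof. by rewrite /master_prob big_cons /= big_map. Qed.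

Lemma master_prob_slave b t : master_prob (Slave b t) = master_prob t.
Proof. by rewrite /master_prob big_map. Qed.

End TreeSums.

(** * Trees of small excess length for any set of symbols *)

Section GoodTrees.
Import mathcomp.boot.fintype mathcomp.boot.finset Defs.
Variables (R : realType) (S : source R).
Notation X := (alphabet S).
Implicit Types (A H L : {set X}) (a b : X) (t : code_tree X) (m v : R).

Local Notation wt := (weight (@prob R S)).

Lemma perm_enum_D1 A a : a \in A -> perm_eq (a :: enum (A :\ a)) (enum A).
Proof.
move=> aA; apply: uniq_perm; rewrite /= ?enum_uniq ?andbT //.
  by rewrite mem_enum !inE eqxx.
move=> x; rewrite inE !mem_enum !inE; by case: eqVneq => [->|].
Qed.

Lemma perm_enum_U H L : [disjoint H & L] ->
  perm_eq (enum H ++ enum L) (enum (H :|: L)).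
Proof.
move=> dHL; apply: uniq_perm; rewrite ?enum_uniq //.
  rewrite cat_uniq !enum_uniq andbT /=; apply/hasPn => x; rewrite !mem_enum => xL.
  by apply: contraTN xL => xH; rewrite (disjointFr dHL).
by move=> x; rewrite mem_cat !mem_enum inE.
Qed.

Lemma tree_weight_enum t A : perm_eq (symbols t) (enum A) -> tree_weight t = wt A.
Proof. by move=> tA; rewrite /tree_weight (perm_big _ tA) big_enum. Qed.

(* Entropy of the probabilities restricted to [A], not normalised, plus the
   allowed excess. *)
Definition budget A : R :=
  \sum_(x in A) eta (prob x) - eta (wt A) + 19 / 50 * wt A.

(** Grouping rule of entropy; the last term is the budget of the single symbol [a]. *)
Lemma budget_D1 A a : a \in A -> budget A =
  budget (A :\ a) + hsplit (prob a) (wt (A :\ a)) + 19 / 50 * prob a.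
Proof.
move=> aA; rewrite /budget /hsplit (weight_D1 _ aA) (big_setD1 a aA) /=; ring.
Qed.

Lemma budget_U H L : [disjoint H & L] ->
  budget (H :|: L) = budget H + budget L + hsplit (wt H) (wt L).
Proof.
move=> dHL; have dLH : [disjoint L & H] by rewrite disjoint_sym.
rewrite /budget /hsplit (weight_U _ dHL) (big_setID H) /=.
rewrite (setIidPr (subsetUl _ _)) setDUl setDv set0U (setDidPl dLH); ring.
Qed.

(** For the share s of [m], the difference 4/5 (2 s - 1)^2 - 9/50 s is convex and negative at both
    ends 9/25 and 11/16. *)
Lemma leaf_margin m v : 0 < m + v -> 9 / 25 * (m + v) <= m -> m <= 11 / 16 * (m + v) ->
  4 / 5 * (m - v) ^+ 2 / (m + v) <= 9 / 50 * m.
Proof.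
move=> W0 h1 h2; rewrite ler_pdivrMr //.
have := mulr_ge0 (_ : 0 <= m - 9 / 25 * (m + v)) (_ : 0 <= 11 / 16 * (m + v) - m).
rewrite !subr_ge0 => /(_ h1 h2) h3.
have h4 := ler_wpM2l (ltW W0) h1; nra.
Qed.

(* The [Num.min] term is the slack that pays for the imperfect balance of
   [good_complete]; without it the induction does not close. *)
Definition good_tree A a t : Prop :=
  [/\ perm_eq (symbols t) (enum A), masters_ok t &
   tree_length t + 19 / 50 * master_prob t <=
   budget A - 1 / 5 * Num.min (prob a) (5 * (wt A - prob a))].

Lemma good_leaf a : good_tree [set a] a (Leaf a).
Proof.
split=> //; first by rewrite enum_set1.
rewrite tree_length_leaf master_prob_leaf /budget /weight !big_set1 !subrr !mulr0.
rewrite min_r ?mulr0; last exact: ltW (prob_gt0 a).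
by have := prob_gt0 a; lra.
Qed.

(** The two edges above [t] cost twice the weight of the rest; [hsplit_ge_min] pays for them and for
    the slack. The master charge of [a] equals its own budget. *)
Lemma good_master A a b t : a \in A -> good_tree (A :\ a) b t ->
  (forall x, x \in A :\ a -> prob x <= prob b) ->
  0 < wt (A :\ a) -> wt (A :\ a) <= 5 / 16 * wt A -> prob b <= wt (A :\ a) ->
  good_tree A a (Master a false (Slave false t)).
Proof.
move=> aA [pt mt ct] mb v0 h bB; split.
- by rewrite symbols_master symbols_slave -(permPr (perm_enum_D1 aA)) perm_cons.
- by rewrite /= mt.
rewrite tree_length_master tree_length_slave tree_weight_slave master_prob_master.
rewrite master_prob_slave (tree_weight_enum pt) (budget_D1 aA).
have EW := weight_D1 (@prob R S) aA; rewrite EW in h *.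
have hs := hsplit_ge_min (prob_gt0 a) v0 h.
have p0 : 0 <= Num.min (prob b) (5 * (wt (A :\ a) - prob b)).
  by rewrite le_min ltW ?prob_gt0 //= mulr_ge0 ?subr_ge0.
have -> : prob a + wt (A :\ a) - prob a = wt (A :\ a) by ring.
move: ct hs p0; move: (Num.min _ _) (Num.min _ _) (hsplit _ _) (budget _) => p q c d.
move: (wt _) (prob _) (tree_length _) (master_prob _) => e f g k *; lra.
Qed.

(** The new edges cost [wt A], covered by the split up to a quadratic deficit. After the new slack,
    the budget of [a] leaves 19/50 - 1/5 = 9/50 of [prob a], and the slack of [t] comes on top. *)
Lemma good_complete_leaf A a b t : a \in A -> good_tree (A :\ a) b t ->
  0 < wt (A :\ a) -> `|prob a - wt (A :\ a)| <= 3 / 8 * wt A ->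
  4 / 5 * (prob a - wt (A :\ a)) ^+ 2 / wt A <=
    9 / 50 * prob a + 1 / 5 * Num.min (prob b) (5 * (wt (A :\ a) - prob b)) ->
  good_tree A a (Complete (Leaf a) t).
Proof.
move=> aA [pt mt ct] v0 h k; split.
- by rewrite symbols_complete -(permPr (perm_enum_D1 aA)) perm_cons.
- by rewrite /= mt.
rewrite tree_length_complete tree_length_leaf master_prob_complete master_prob_leaf.
rewrite (tree_weight_enum pt) (budget_D1 aA).
have -> : tree_weight (Leaf a : code_tree X) = prob a.
  by rewrite /tree_weight big_seq1.
have EW := weight_D1 (@prob R S) aA; rewrite EW in h k *.
have hs := hsplit_ge_quadratic (prob_gt0 a) v0 h.
have q0 : Num.min (prob a) (5 * (prob a + wt (A :\ a) - prob a)) <= prob a.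
  by rewrite ge_min lexx.
move: ct k hs q0; move: (Num.min _ _) (Num.min _ _) (hsplit _ _) (budget _) => p q c d.
move: (4 / 5 * _ / _) => z.
move: (wt _) (prob _) (tree_length _) (master_prob _) => e f g i *; lra.
Qed.

(** As the gap is at most a quarter of [wt A], the deficit of the split is at most a fifth of the
    gap; the slacks of the subtrees pay for it and for the new slack. *)
Lemma good_complete A H L a b x y tH tL : H :|: L = A -> [disjoint H & L] ->
  good_tree H x tH -> good_tree L y tL ->
  wt L <= wt H -> wt H - wt L <= 1 / 4 * wt A -> wt H - wt L <= wt A - 12 / 5 * prob a ->
  prob x <= prob a -> prob y <= prob a -> 0 < wt H -> 0 < wt L ->
  prob a + (wt H - wt L) <= prob x + prob y ->
  good_tree A a (Complete tH tL).
Proof.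
move=> EA dHL [pH mH cH] [pL mL cL] LH d1 d2 xa ya H0 L0 xy; split.
- by rewrite symbols_complete -EA -(permPr (perm_enum_U dHL)) perm_cat.
- by rewrite /= mH.
have EW : wt A = wt H + wt L by rewrite -EA weight_U.
rewrite tree_length_complete master_prob_complete (tree_weight_enum pH).
rewrite (tree_weight_enum pL) -[in budget A]EA (budget_U dHL).
(* By the bound with 12/5, both sides weigh at least 6/5 of [prob a], so each minimum is its first
   argument. *)
rewrite min_l in cH; last by lra.
rewrite min_l in cL; last by lra.
have q0 : Num.min (prob a) (5 * (wt A - prob a)) <= prob a by rewrite ge_min lexx.
have W0 : 0 < wt H + wt L by rewrite addr_gt0.
have hs : wt H + wt L - 4 / 5 * (wt H - wt L) ^+ 2 / (wt H + wt L) <= hsplit (wt H) (wt L).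
  by apply: hsplit_ge_quadratic; rewrite // ger0_norm ?subr_ge0 //; lra.
have dd : 4 / 5 * (wt H - wt L) ^+ 2 / (wt H + wt L) <= 1 / 5 * (wt H - wt L).
  rewrite ler_pdivrMr // EW in d1 *.
  have d0 : 0 <= wt H - wt L by rewrite subr_ge0.
  have := ler_wpM2l d0 d1; nra.
move: q0 hs dd cH cL xy; move: (Num.min _ _) (hsplit _ _) (budget _) (budget _) => p c d e.
move: (4 / 5 * _ / _) => z; move: (wt _) (wt _) => i j.
by move: (prob _) (prob _) (prob _) (tree_length _) (master_prob _) (tree_length _) (master_prob _)=> *; lra.
Qed.

(** Induction on the size of [A]. In the balanced case, a gap above [wt A - 12 / 5 * prob a] makes
    the second symbol [b] likely as well; [a] then becomes a leaf after all, paid for by the slack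
    of [b]. *)
Theorem exists_good_tree A a : a \in A -> (forall x, x \in A -> prob x <= prob a) ->
  exists t, good_tree A a t.
Proof.
move: {2}#|A| (leqnn #|A|) => n; elim: n A a => [|n IH] A a.
  by rewrite leqn0 cards_eq0 => /eqP ->; rewrite inE.
move=> An aA maxa.
have pos := @prob_gt0 R S.
have EW := weight_D1 (@prob R S) aA.
have [B0|B0] := eqVneq (A :\ a) set0.
  exists (Leaf a); have -> : A = [set a] by rewrite -(setD1K aA) B0 setU0.
  exact: good_leaf.
have [b bB maxb] := argmax (@prob R S) B0.
have [t gt] : exists t, good_tree (A :\ a) b t.
  by apply: IH => //; rewrite -ltnS (leq_trans _ An) // [#|A|](cardsD1 a) aA.
have v0 : 0 < wt (A :\ a) := weight_gt0 pos bB.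
have bv : prob b <= wt (A :\ a).
  by rewrite (weight_D1 _ bB) lerDl weight_ge0.
have ba : prob b <= prob a by apply: maxa; move: bB; rewrite !inE => /andP[].
have p0 := pos a; have b0 := pos b.
have [c1|c1] := leP (wt (A :\ a)) (5 / 16 * wt A).
  by exists (Master a false (Slave false t)); apply: good_master gt _ _ _ _.
have W0 : 0 < wt A := weight_gt0 pos aA.
have [c2|c2] := leP (9 / 25 * wt A) (prob a).
  exists (Complete (Leaf a) t); apply: good_complete_leaf gt _ _ _ => //.
    by rewrite ler_norml; move: (wt _) (wt _) (prob _) EW c1 c2 v0 p0 W0 => *; apply/andP; split; lra.
  have q0 : 0 <= Num.min (prob b) (5 * (wt (A :\ a) - prob b)).
    by rewrite le_min ltW ?pos //= mulr_ge0 ?subr_ge0.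
  have := @leaf_margin (prob a) (wt (A :\ a)); rewrite -EW => h.
  have {}h := h W0 c2 ltac:(lra).
  by apply: le_trans h _; rewrite lerDl mulr_ge0.
have A0 : A != set0 by apply/set0Pn; exists a.
have [x xA|H [L [EA dHL LH Hd [y yL Ld]]]] := balanced_split pos A0.
  by apply: le_lt_trans (maxa x xA) _; lra.
have EWA : wt A = wt H + wt L by rewrite -EA weight_U.
have HA : H \subset A by rewrite -EA subsetUl.
have LA : L \subset A by rewrite -EA subsetUr.
have [z zH] : exists z, z \in H.
  apply/set0Pn; apply/eqP => H0; move: (weight_gt0 pos yL) LH.
  by rewrite H0 weight_set0 leNgt => ->.
have Hz := Hd z zH.
have heavy : wt A < 5 * (wt H - wt L) -> wt H <= prob a + prob b.
  by move=> big; apply: heavy_side_le EA dHL Hd big aA maxa maxb.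
have [c3|c3] := leP (wt H - wt L) (wt A - 12 / 5 * prob a).
  (* When [heavy] applies, the gap is at most 4 [prob a] - [wt A]; with [c3] the worst case is
     [prob a] = 5/16 [wt A], where both bounds equal 1/4 [wt A]. *)
  have d4 : wt H - wt L <= 1 / 4 * wt A.
    have [c4|/heavy c4] := leP (5 * (wt H - wt L)) (wt A); first by lra.
    by lra.
  have [|x xH maxx] := argmax (@prob R S) (_ : H != set0).
    by apply/set0Pn; exists z.
  have [|u uL maxu] := argmax (@prob R S) (_ : L != set0).
    by apply/set0Pn; exists y.
  have cardHL : (#|A| = #|H| + #|L|)%N by rewrite -EA cardsU disjoint_setI0 // cards0 subn0.
  have [tH gH] : exists t, good_tree H x t.
    apply: IH => //; rewrite -ltnS (leq_trans _ An) // cardHL -addn1 leq_add2l card_gt0.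
    by apply/set0Pn; exists y.
  have [tL gL] : exists t, good_tree L u t.
    apply: IH => //; rewrite -ltnS (leq_trans _ An) // cardHL -add1n leq_add2r card_gt0.
    by apply/set0Pn; exists z.
  exists (Complete tH tL).
  apply: (good_complete a EA dHL gH gL) => //.
  - exact/maxa/(subsetP HA).
  - exact/maxa/(subsetP LA).
  - exact: weight_gt0 zH.
  - exact: weight_gt0 yL.
  (* The side of [a] has maximum at least [prob a], the other side contains [y] or [z], of weight at
     least the gap. *)
  - move: aA; rewrite -EA inE => /orP[aH|aL].
      by apply: lerD; [exact: maxx|exact: le_trans Ld (maxu _ yL)].
    by rewrite addrC; apply: lerD; [exact: le_trans Hz (maxx _ zH)|exact: maxu].
(* [z] and [y] lie on different sides, so one of them is not [a]. *)
have bd : wt H - wt L <= prob b.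
  have [Ea|nza] := eqVneq z a; last first.
    by apply: le_trans Hz (maxb z _); rewrite !inE nza (subsetP HA).
  apply: le_trans Ld (maxb y _); rewrite !inE (subsetP LA) // andbT.
  by apply: contraTneq yL => ->; rewrite -Ea (disjointFr dHL).
exists (Complete (Leaf a) t).
have minE : Num.min (prob b) (5 * (wt (A :\ a) - prob b)) = prob b by rewrite min_l //; lra.
have key : 5 / 16 * wt A <= prob a /\
   4 / 5 * (prob a - wt (A :\ a)) ^+ 2 <= (9 / 50 * prob a + 1 / 5 * prob b) * wt A.
  have Ev : wt (A :\ a) = wt A - prob a by lra.
  rewrite Ev.
  (* Below 1/3 the gap exceeds a fifth of [wt A], so [heavy] improves the bound on [prob b]; since
     [prob b <= prob a], it also forces the share 5/16 that the quadratic estimate requires. *)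
  have [c5|c5] := leP (1 / 3 * wt A) (prob a).
    have bb : wt A - 12 / 5 * prob a <= prob b by lra.
    split; first by lra.
    have h := ler_wpM2r (ltW W0) bb.
    have k : 0 <= (prob a - 1 / 3 * wt A) * (9 / 25 * wt A - prob a) by apply: mulr_ge0; lra.
    have k2 := ler_wpM2r (ltW W0) c5.
    move: h k k2; clear; move: (prob a) (prob b) (wt A) => m q W; nra.
  have c6 : wt A < 5 * (wt H - wt L) by lra.
  have c7 := heavy c6.
  have bb : wt A - 11 / 5 * prob a <= prob b by lra.
  have c8 : 5 / 16 * wt A <= prob a by lra.
  split=> //.
  have h := ler_wpM2r (ltW W0) bb.
  have k : 0 <= (prob a - 5 / 16 * wt A) * (1 / 3 * wt A - prob a) by apply: mulr_ge0; lra.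
  have k2 := ler_wpM2r (ltW W0) c8.
  move: h k k2; clear; move: (prob a) (prob b) (wt A) => m q W; nra.
case: key => k1 k2.
apply: (good_complete_leaf aA gt) => //.
  by rewrite ler_norml; move: (wt _) (wt _) (prob _) EW c1 c2 v0 p0 W0 k1 => *; apply/andP; split; lra.
by rewrite minE ler_pdivrMr.
Qed.

End GoodTrees.

(** * Upper bound on the redundancy *)

Section UpperBound.
Import mathcomp.boot.fintype mathcomp.boot.finset Defs.
Variables (R : realType) (S : source R).
Notation X := (alphabet S).
Implicit Types (A H L : {set X}) (a b : X) (t : code_tree X) (m v : R).
Local Notation wt := (weight (@prob R S)).
Local Notation f := (@Defs.f R).

Lemma pmax_attained : exists2 a : X, prob a = pmax S & forall x : X, prob x <= prob a.
Proof.
have /card_gt0P[x0 _] : (0 < #|X|)%N by apply: leq_trans (alphabet_ge2 S).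
have T0 : [set: X] != set0 by apply/set0Pn; exists x0; rewrite inE.
have [a _ maxa] := argmax (@prob R S) T0.
have {}maxa (x : X) : prob x <= prob a by apply: maxa; rewrite inE.
exists a => //; apply/le_anti/andP; split; first exact: le_bigmax.
by apply: bigmax_le => //; apply/ltW/prob_gt0.
Qed.

Lemma entropyE : entropy S = \sum_(x : X) eta (prob x).
Proof. by rewrite /entropy -sumrN. Qed.

Lemma master_prob_le_weight t : master_prob t <= tree_weight t.
Proof.
rewrite /master_prob /tree_weight big_map [leRHS](bigID (fun e : X * seq bool * bool => e.2)) /=.
by rewrite lerDl; apply: sumr_ge0 => e _; apply/ltW/prob_gt0.
Qed.

Lemma optimal_length_le (T0 T1 : code_tree X) : is_AIFV T0 T1 ->
  optimal_length S <= AIFV_length (tree_length T0) (master_prob T0)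
                                  (tree_length T1) (master_prob T1).
Proof.
move=> c; rewrite /optimal_length; case: cid => L [_ lb] /=; apply: lb.
by exists T0, T1; split=> //; apply/average_lengthE.
Qed.

Lemma redundancy_le : 2^-1 <= pmax S < 1 -> redundancy S <= f (pmax S).
Proof.
have [a <- maxa] := pmax_attained; move=> /andP[p1 p2].
have aT : a \in [set: X] by rewrite inE.
have EW := weight_D1 (@prob R S) aT.
have WT : wt [set: X] = 1.
  by rewrite -(prob_sum1 S) /weight; apply: eq_bigl => x; rewrite inE.
rewrite WT in EW.
have B0 : [set: X] :\ a != set0.
  rewrite -card_gt0; have := cardsD1 a [set: X]; rewrite cardsT inE /= => E.
  by have := alphabet_ge2 S; rewrite E add1n ltnS.
have [b bB maxb] := argmax (@prob R S) B0.
have [t [pt mt ct]] := exists_good_tree bB maxb.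
have bv : prob b <= wt ([set: X] :\ a).
  by rewrite (weight_D1 _ bB) lerDl weight_ge0 //; exact: prob_gt0.
have min0 : 0 <= Num.min (prob b) (5 * (wt ([set: X] :\ a) - prob b)).
  by rewrite le_min ltW ?prob_gt0 //= mulr_ge0 ?subr_ge0.
have qv := master_prob_le_weight t; rewrite (tree_weight_enum pt) in qv.
have q0 := master_prob_ge0 t.
have WL : tree_weight (Leaf a : code_tree X) = prob a by rewrite /tree_weight big_seq1.
have Wt := tree_weight_enum pt.
have Ew : wt ([set: X] :\ a) = 1 - prob a by lra.
have EH : entropy S = binary_entropy (prob a) + (budget ([set: X] :\ a) - 19 / 50 * (1 - prob a)).
  rewrite entropyE /budget Ew /binary_entropy (bigD1 a) //= /eta.
  rewrite (eq_bigl (fun x => x \in [set: X] :\ a)); last by move=> x; rewrite !inE andbT.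
  by move: (\sum_(i in _) _) => z; ring.
have perm1 : perm_eq (a :: symbols t) (enum X).
  have -> : enum X = enum [set: X] by apply: eq_enum => x; rewrite !inE.
  by rewrite -(permPr (perm_enum_D1 aT)) perm_cons.
pose T1 : code_tree X := Complete (Slave true t) (Leaf a).
have ok1 T0 : bijective_assignment T0 -> masters_ok T0 -> is_AIFV T0 T1.
  move=> b0 m0; rewrite /is_AIFV b0 m0 /= mt /= andbT.
  rewrite /bijective_assignment -/(symbols T1) symbols_complete symbols_slave.
  by rewrite perm_catC.
have L1 : tree_length T1 = tree_length t + 2 * (1 - prob a) + prob a.
  rewrite tree_length_complete tree_length_slave tree_weight_slave tree_length_leaf Wt WL Ew.
  ring.
have Q1 : master_prob T1 = master_prob t.
  by rewrite master_prob_complete master_prob_slave master_prob_leaf addr0.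
have /andP[s1 s2] := sqrt5_bounds R.
rewrite /redundancy EH /Defs.f; case: ifP => [pphi|/negbT pphi].
  pose T0 : code_tree X := Complete (Leaf a) t.
  have c : is_AIFV T0 T1.
    apply: ok1; last by rewrite /= mt.
    by rewrite /bijective_assignment -/(symbols T0) symbols_complete.
  have L0 : tree_length T0 = tree_length t + (1 - prob a) + prob a.
    by rewrite tree_length_complete tree_length_leaf Wt WL Ew; ring.
  have Q0 : master_prob T0 = master_prob t.
    by rewrite master_prob_complete master_prob_leaf add0r.
  (* Both trees have master probability q = [master_prob t], so the stationary weights are 1 - q and
     q. With w = 1 - [prob a] the average length is [tree_length t] + 1 + q w, and 1 + w^2 is the
     polynomial in [f]. *)
  have := optimal_length_le c; rewrite /AIFV_length L0 L1 Q0 Q1.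
  rewrite subrK !divr1.
  move: (optimal_length S) => o ho.
  (* That is, w is at least 19/50. *)
  have p3 : prob a <= 31 / 50 by lra.
  have k : 0 <= (31 / 50 - prob a) * (1 - prob a - master_prob t) by apply: mulr_ge0; lra.
  rewrite Ew in ct min0.
  move: (Num.min _ _) (budget _) (binary_entropy _) (tree_length _) ct min0 ho => p q r s *.
  nra.
pose T0 : code_tree X := Master a false (Slave false t).
have c : is_AIFV T0 T1.
  apply: ok1; last by rewrite /= mt.
  by rewrite /bijective_assignment -/(symbols T0) symbols_master symbols_slave.
have L0 : tree_length T0 = tree_length t + 2 * (1 - prob a).
  by rewrite tree_length_master tree_length_slave tree_weight_slave Wt Ew; ring.
have Q0 : master_prob T0 = prob a + master_prob t.
  by rewrite master_prob_master master_prob_slave.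
have := optimal_length_le c; rewrite /AIFV_length L0 L1 Q0 Q1.
have -> : 1 - master_prob t + (prob a + master_prob t) = 1 + prob a by ring.
rewrite -ltNge in pphi.
(* Equivalent to p / (1 + p) >= 19/50 for p = [prob a]. *)
have p3 : 19 / 31 <= prob a by lra.
have D0 : 0 < 1 + prob a by lra.
have -> : (1 - master_prob t) / (1 + prob a) * (tree_length t + 2 * (1 - prob a)) +
  (prob a + master_prob t) / (1 + prob a) * (tree_length t + 2 * (1 - prob a) + prob a) =
  tree_length t + (2 - prob a ^+ 2 * 2 + prob a * (prob a + master_prob t)) / (1 + prob a).
  by field; rewrite gt_eqF.
move: (optimal_length S) => o ho.
have k : 0 <= (31 / 50 * prob a - 19 / 50) * (1 - prob a - master_prob t) by apply: mulr_ge0; lra.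
(* With p / (1 + p) in place of 19/50 this is an equality. *)
have k2 : (2 - prob a ^+ 2 * 2 + prob a * (prob a + master_prob t)) / (1 + prob a) +
   19 / 50 * (1 - prob a - master_prob t) <= (- 2 * prob a ^+ 2 + prob a + 2) / (1 + prob a).
  by rewrite -lerBrDl -mulrBl ler_pdivlMr //; nra.
rewrite Ew in ct min0.
move: k2 ct min0 ho; move: (_ / (1 + prob a)) (_ / (1 + prob a)) => x y.
by move: (Num.min _ _) (budget _) (binary_entropy _) (tree_length _) => p q r s *; lra.
Qed.

End UpperBound.

(** * Lower bound on the code length by duality *)

Section LowerBound.
Import Defs.
Variables (R : realType) (S : source R).
Notation X := (alphabet S).
Implicit Types (a b x y : X) (t l r : code_tree X) (c : R).

Lemma masters_ok_master x d t : masters_ok (Master x d t) ->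
  exists t', t = Slave false t'.
Proof.
by case/and3P=> _; case: t => // b t /negbTE -> _; exists t.
Qed.

Lemma T1_root_okP t : T1_root_ok t -> exists l r, t = Complete (Slave true l) r.
Proof. by case: t => [//|[//|//|//|[] l] r|//|//] // _; exists l, r. Qed.

(** Weak duality: in the combination with weights 1 - q1 and q0, the terms in [c] amount to c q0 on
    both sides and cancel. *)
Lemma AIFV_length_ge (l0 q0 l1 q1 c g : R) : 0 <= q0 -> q1 < 1 ->
  g <= l0 + c * q0 -> g + c <= l1 + c * q1 -> g <= AIFV_length l0 q0 l1 q1.
Proof.
move=> q0_ge0 q1_lt1 h0 h1; have D0 : 0 < 1 - q1 + q0 by lra.
rewrite /AIFV_length mulrAC [q0 / _ * _]mulrAC -mulrDl ler_pdivlMr //.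
have := ler_wpM2l (_ : 0 <= 1 - q1) h0; have := ler_wpM2l q0_ge0 h1.
by move=> k1 /(_ ltac:(lra)) k2; lra.
Qed.

Lemma prob_le_tree_weight t x : x \in symbols t -> prob x <= tree_weight t.
Proof.
move=> xt; rewrite /tree_weight (big_rem x) //= lerDl.
by apply: sumr_ge0 => y _; apply/ltW/prob_gt0.
Qed.

Lemma prob2_le_tree_weight t x y : x != y -> x \in symbols t -> y \in symbols t ->
  prob x + prob y <= tree_weight t.
Proof.
move=> xy xt yt; rewrite /tree_weight (big_rem x) //= lerD2l.
have yr : y \in rem x (symbols t).
  by move: yt; rewrite (perm_mem (perm_to_rem xt)) inE eq_sym (negbTE xy).
rewrite (big_rem y) //= lerDl.
by apply: sumr_ge0 => z _; apply/ltW/prob_gt0.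
Qed.

Lemma tree_weight_ge0 t : 0 <= tree_weight t.
Proof. by apply: sumr_ge0 => x _; apply/ltW/prob_gt0. Qed.

Lemma cost_ge0 c t : 0 <= c -> 0 <= tree_length t + c * master_prob t.
Proof. by move=> c0; rewrite addr_ge0 ?mulr_ge0 ?tree_length_ge0 ?master_prob_ge0. Qed.

(** With two symbols the root is not a leaf, so [x] is the master at the root or has depth at least
    one. *)
Lemma cost_ge_prob c t x : 0 <= c <= 1 -> (1 < size (symbols t))%N ->
  x \in symbols t -> c * prob x <= tree_length t + c * master_prob t.
Proof.
move=> /andP[c0 c1]; have px := prob_gt0 x.
have cp : c * prob x <= prob x by rewrite ger_pMl.
case: t => [z //|l r|z b t|b t] _.
- rewrite tree_length_complete master_prob_complete.
  move=> /prob_le_tree_weight; rewrite tree_weight_complete.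
  have := cost_ge0 l c0; have := cost_ge0 r c0; move=> *; lra.
- rewrite tree_length_master master_prob_master symbols_master inE.
  have h1 := cost_ge0 t c0; have h2 := tree_weight_ge0 t.
  have h3 := mulr_ge0 c0 (ltW (prob_gt0 z)).
  by move=> /predU1P[->|/prob_le_tree_weight h4]; move=> *; lra.
- rewrite tree_length_slave master_prob_slave => /prob_le_tree_weight.
  rewrite tree_weight_slave; have := cost_ge0 t c0; move=> *; lra.
Qed.

Section ThreeSymbols.
Variables a b : X.
Hypothesis ab : a != b.
Hypothesis ba : prob b <= prob a.

(** The first term bounds trees with [a] or [b] as master at the root, the second all others. The
    third symbol is neglected, as its probability will tend to 0. *)
Lemma cost_T0_ge c t : 0 <= c <= 1 -> size (symbols t) = 3%N ->
  a \in symbols t -> b \in symbols t -> masters_ok t ->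
  Num.min (c * prob a + 2 * prob b + c * prob b) (prob a + prob b + c * prob b)
    <= tree_length t + c * master_prob t.
Proof.
move=> c01; have /andP[c0 c1] := c01; have ba' := ba.
have cab := ler_wpM2l c0 ba; have pa := prob_gt0 a; have pb := prob_gt0 b.
have cb : c * prob b <= prob b by rewrite ger_pMl.
case: t => [z //|l r|z d t0|d t].
- rewrite symbols_complete size_cat !mem_cat tree_length_complete master_prob_complete.
  move=> sz at_ bt _; rewrite ge_min; apply/orP; right.
  have := @prob2_le_tree_weight (Complete l r) a b ab.
  rewrite symbols_complete !mem_cat tree_weight_complete => /(_ at_ bt) hw.
  have hl := cost_ge0 l c0; have hr := cost_ge0 r c0.
  (* One of the two subtrees has two symbols, among them [a] or [b]. *)
  suff : c * prob b <= tree_length l + c * master_prob l \/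
    c * prob b <= tree_length r + c * master_prob r by case; move=> *; lra.
  have [al|] := boolP (a \in symbols l); have [bl|] := boolP (b \in symbols l).
  + left; apply: cost_ge_prob => //.
    case: (symbols l) al bl => [//|u [|v s]] //.
    by rewrite !inE => /eqP E1 /eqP E2; move: ab; rewrite E1 E2 eqxx.
  + move=> bl; have br : b \in symbols r by move: bt; rewrite (negbTE bl).
    have [s2|s2] := ltnP 1 (size (symbols l)).
      by left; apply: le_trans cab _; apply: cost_ge_prob.
    right; apply: cost_ge_prob => //; move: sz s2.
    by case: (size (symbols l)) => [|[|k]] //; case: (size (symbols r)) => [|[|m]].
  + move=> al; have ar : a \in symbols r by move: at_; rewrite (negbTE al).
    have [s2|s2] := ltnP 1 (size (symbols l)).
      by left; apply: cost_ge_prob.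
    right; apply: le_trans cab _; apply: cost_ge_prob => //; move: sz s2.
    by case: (size (symbols l)) => [|[|k]] //; case: (size (symbols r)) => [|[|m]].
  + move=> bl al; right; apply: cost_ge_prob => //; last by move: bt; rewrite (negbTE bl).
    move: at_ bt; rewrite (negbTE al) (negbTE bl) /=.
    case: (symbols r) => [//|u [|v s]] //.
    by rewrite !inE => /eqP E1 /eqP E2; move: ab; rewrite E1 E2 eqxx.
- move=> + + + /masters_ok_master[t E]; rewrite E symbols_master symbols_slave !inE.
  move=> -[s2] at_ bt.
  rewrite tree_length_master master_prob_master tree_length_slave tree_weight_slave.
  rewrite master_prob_slave.
  have hc x := @cost_ge_prob c t x c01 (eq_leq (esym s2)).
  have [Ea|na] := eqVneq a z.
    move: bt; rewrite -Ea eq_sym (negbTE ab) /= => bt.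
    have := hc b bt; have := prob_le_tree_weight bt => *.
    by rewrite ge_min; apply/orP; left; move=> *; lra.
  rewrite (negbTE na) /= in at_.
  have [Eb|nb] := eqVneq b z.
    have := hc a at_; have := prob_le_tree_weight at_ => *.
    by rewrite -Eb ge_min; apply/orP; left; lra.
  rewrite (negbTE nb) /= in bt.
  have := hc b bt; have := prob2_le_tree_weight ab at_ bt.
  have := mulr_ge0 c0 (ltW (prob_gt0 z)) => *.
  by rewrite ge_min; apply/orP; right; move=> *; lra.
- rewrite symbols_slave => sz at_ bt _; rewrite tree_length_slave master_prob_slave.
  have := @cost_ge_prob c t b c01 _ bt; rewrite sz => /(_ isT).
  have := prob2_le_tree_weight ab at_ bt => *.
  by rewrite ge_min; apply/orP; right; move=> *; lra.
Qed.

(** Both symbols have depth at least one, or a master at the root leaves one of them at depth at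
    least two; either way the length is at least 2 [prob b]. *)
Lemma cost_pair_ge c t : 0 <= c <= 1 ->
  a \in symbols t -> b \in symbols t -> masters_ok t ->
  prob b + c * prob b <= tree_length t + c * master_prob t.
Proof.
move=> c01; have /andP[c0 c1] := c01; have ba' := ba.
have cab := ler_wpM2l c0 ba; have pa := prob_gt0 a; have pb := prob_gt0 b.
have cb : c * prob b <= prob b by rewrite ger_pMl.
case: t => [z|l r|z d t0|d t].
- by rewrite !inE => /eqP E1 /eqP E2; move: ab; rewrite E1 E2 eqxx.
- move=> at_ bt _; rewrite tree_length_complete master_prob_complete.
  have := prob2_le_tree_weight ab at_ bt; rewrite tree_weight_complete.
  have := cost_ge0 l c0; have := cost_ge0 r c0 => *; lra.
- move=> + + /masters_ok_master[t E]; rewrite E symbols_master symbols_slave !inE.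
  move=> at_ bt.
  rewrite tree_length_master master_prob_master tree_length_slave tree_weight_slave.
  rewrite master_prob_slave; have h := cost_ge0 t c0.
  have [Ea|na] := eqVneq a z.
    move: bt; rewrite -Ea eq_sym (negbTE ab) /= => bt.
    by have := prob_le_tree_weight bt => *; lra.
  rewrite (negbTE na) /= in at_.
  have := prob_le_tree_weight at_; have := mulr_ge0 c0 (ltW (prob_gt0 z)) => *; lra.
- rewrite symbols_slave => at_ bt _; rewrite tree_length_slave master_prob_slave.
  have := cost_ge0 t c0; have := prob2_le_tree_weight ab at_ bt => *; lra.
Qed.

(** Symbols on the 0 side of the root have depth at least two. If [a] and [b] are both there,
    lengths suffice; if both are on the 1 side, [cost_pair_ge] applies to it; otherwise one side has
    two symbols and [cost_ge_prob] applies. *)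
Lemma cost_T1_ge c t : 0 <= c <= 1 -> size (symbols t) = 3%N ->
  a \in symbols t -> b \in symbols t -> masters_ok t -> T1_root_ok t ->
  prob a + 2 * prob b + c * prob b <= tree_length t + c * master_prob t.
Proof.
move=> c01; have /andP[c0 c1] := c01; have ba' := ba.
have cab := ler_wpM2l c0 ba; have pa := prob_gt0 a; have pb := prob_gt0 b.
have cb : c * prob b <= prob b by rewrite ger_pMl.
move=> + + + + /T1_root_okP[l [r E]]; rewrite E symbols_complete symbols_slave.
rewrite size_cat !mem_cat /= => sz at_ bt /andP[_ mr].
rewrite tree_length_complete tree_length_slave tree_weight_slave.
rewrite master_prob_complete master_prob_slave.
have hl := cost_ge0 l c0; have hr := cost_ge0 r c0.
have wl := tree_weight_ge0 l; have wr := tree_weight_ge0 r.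
have big x y : x \in symbols l -> y \in symbols r ->
    c * prob x <= tree_length l + c * master_prob l \/
    c * prob y <= tree_length r + c * master_prob r.
  move=> xl yr; have [s2|s2] := ltnP 1 (size (symbols l)).
    by left; apply: cost_ge_prob.
  right; apply: cost_ge_prob => //; move: sz s2.
  by case: (size (symbols l)) => [|[|k]] //; case: (size (symbols r)) => [|[|m]].
have [al|] := boolP (a \in symbols l); have [bl|] := boolP (b \in symbols l).
- by have := prob2_le_tree_weight ab al bl => *; lra.
- move=> bl; have br : b \in symbols r by move: bt; rewrite (negbTE bl).
  have := prob_le_tree_weight al; have := prob_le_tree_weight br.
  by case: (big _ _ al br) => *; lra.
- move=> al; have ar : a \in symbols r by move: at_; rewrite (negbTE al).
  have := prob_le_tree_weight bl; have := prob_le_tree_weight ar.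
  by case: (big _ _ bl ar) => *; lra.
move=> bl al; have br : b \in symbols r by move: bt; rewrite (negbTE bl).
have ar : a \in symbols r by move: at_; rewrite (negbTE al).
have := prob2_le_tree_weight ab ar br; have := cost_pair_ge c01 ar br mr => *; lra.
Qed.

Lemma optimal_length_ge c g : #|X| = 3%N -> 0 <= c <= 1 ->
  g <= c * prob a + 2 * prob b + c * prob b -> g <= prob a + prob b + c * prob b ->
  g + c <= prob a + 2 * prob b + c * prob b -> g <= optimal_length S.
Proof.
move=> card3 c01 g1 g2 g3; rewrite /optimal_length; case: cid => L [[T0 [T1 [ok av]]] _] /=.
have /and5P[b0 m0 b1 m1 r1] := ok.
have sz t : bijective_assignment t -> size (symbols t) = 3%N.
  by move=> bt; rewrite (perm_size bt) -cardE card3.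
have mem t x : bijective_assignment t -> x \in symbols t.
  by move=> bt; rewrite (perm_mem bt) mem_enum.
move/(average_lengthE _ ok): av => ->.
have [d d0 dP] := min_prob S; have := master_prob_le dP b1 => q1.
apply: (@AIFV_length_ge _ _ _ _ c); rewrite ?master_prob_ge0 //; first by lra.
  by apply: le_trans (cost_T0_ge c01 (sz _ b0) (mem _ _ b0) (mem _ _ b0) m0); rewrite le_min g1 g2.
exact: le_trans g3 (cost_T1_ge c01 (sz _ b1) (mem _ _ b1) (mem _ _ b1) m1 r1).
Qed.

End ThreeSymbols.
End LowerBound.

(** * Sources approaching the bound, and the supremum *)

Section WorstCase.
Variable R : realType.
Implicit Types p s e : R.
Local Notation f := (@Defs.f R).

(** The square makes the bound linear in [s], by ln (1 / s) <= 1 / s - 1. *)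
Lemma eta_sqr_le s : 0 < s -> eta (s ^+ 2) <= 2 * s / ln 2.
Proof.
move=> s0; have l2 := ln2_gt0 R.
rewrite /eta /log2 mulrA -mulNr ler_pM2r ?invr_gt0 // lnXn // mulr2n.
have si : 0 < s^-1 by rewrite invr_gt0.
have := ler_wpM2l (exprn_ge0 2 (ltW s0)) (le_lnB1 si).
rewrite lnV ?posrE // mulrBr expr2 mulfK ?gt_eqF //.
have : 0 < s * s by rewrite mulr_gt0.
move: (s * s) (ln s) => q l *; lra.
Qed.

(** From (w - e) ln (w / (w - e)) <= e and ln w <= 0. *)
Lemma eta_subr_le w e : 0 < e < w -> w <= 1 -> eta (w - e) <= eta w + e / ln 2.
Proof.
move=> /andP[e0 ew] w1; have l2 := ln2_gt0 R.
have w0 : 0 < w by lra.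
have d0 : 0 < w - e by lra.
have h := ler_wpM2l (ltW d0) (le_lnB1 (divr_gt0 w0 d0)).
rewrite mulrBr [in X in _ <= X]mulrC divfK ?gt_eqF // ln_div ?posrE // in h.
have k : e * ln w <= 0 by rewrite mulr_ge0_le0 ?ln_le0 // ltW.
rewrite /eta /log2 !mulrA -!mulNr -mulrDl ler_pM2r ?invr_gt0 //; lra.
Qed.

Lemma three_symbol_source p e : 2^-1 <= p -> 0 < e < 1 - p ->
  exists S : source R, exists a b : alphabet S,
  a != b /\ [/\ #|alphabet S| = 3%N, prob a = p, prob b = 1 - p - e, pmax S = p &
      entropy S = eta p + eta (1 - p - e) + eta e].
Proof.
move=> p2 /andP[e0 ew].
pose P (i : 'I_3) : R := [:: p; 1 - p - e; e]`_i.
have P_gt0 i : 0 < P i.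
  by case: i => [[|[|[|]]] ?] //; rewrite /P /=; lra.
have P_sum : \sum_i P i = 1 by rewrite !big_ord_recl big_ord0 /P /=; ring.
have P_ge2 : (2 <= #|'I_3|)%N by rewrite card_ord.
pose S := @Source R 'I_3 P P_ge2 P_gt0 P_sum.
exists S, (Ordinal (isT : (0 < 3)%N)), (Ordinal (isT : (1 < 3)%N)).
split=> //; split=> //; first exact: card_ord.
  rewrite /pmax /= !big_ord_recl big_ord0 /P /=.
  by apply/max_idPl; rewrite !ge_max; apply/and3P; split; lra.
by rewrite entropyE /= !big_ord_recl big_ord0 /P /= addr0 addrA.
Qed.

Lemma le_golden_ratio p : 0 <= p ->
  (p <= (-1 + Num.sqrt 5) / 2) = (p ^+ 2 + p <= 1).
Proof.
move=> p0; have -> : (p ^+ 2 + p <= 1) = ((2 * p + 1) ^+ 2 <= Num.sqrt 5 ^+ 2).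
  by rewrite sqr_sqrtr //; apply/idP/idP => h; lra.
rewrite ler_sqr ?nnegrE ?sqrtr_ge0 //; last lra.
by apply/idP/idP => h; lra.
Qed.

(* [c] is the dual multiplier: the three bounds are what [optimal_length_ge] asks
   for in the limit of a vanishing third symbol. *)
Lemma exists_multiplier p : 2^-1 <= p < 1 ->
  exists c, [/\ 0 <= c, c <= 1 / 2,
    f p + binary_entropy p <= c + 2 * (1 - p),
    f p + binary_entropy p <= 1 + c * (1 - p) &
    f p + binary_entropy p + c <= 2 - p + c * (1 - p)].
Proof.
move=> /andP[p2 p1]; have p0 : 0 <= p by lra.
rewrite /Defs.f le_golden_ratio //; case: ifP => [phi|/negbT phi].
  (* The last two bounds become equalities, the first one p^2 + p <= 1. *)
  exists (1 - p); rewrite subrK.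
  by split; [lra|lra|lra|rewrite -expr2; lra|rewrite -expr2; lra].
rewrite -ltNge in phi; rewrite subrK.
have D0 : 0 < 1 + p by lra.
(* Here the first and third bounds are equalities, and the second one is p^2 + p >= 1. *)
exists (p / (1 + p)); split.
- by rewrite divr_ge0 // ltW.
- by rewrite ler_pdivrMr //; lra.
- by rewrite ler_pdivrMr // mulrDl divfK ?gt_eqF //; lra.
- rewrite ler_pdivrMr // mulrDl mulrAC divfK ?gt_eqF //; lra.
- by rewrite -mulrDl ler_pdivrMr // mulrDl mulrAC divfK ?gt_eqF //; lra.
Qed.

(** The third symbol gets probability s^2; the losses in length and entropy are at most 3 s^2, 4 s
    and s. *)
Lemma redundancy_close p s : 2^-1 <= p < 1 -> 0 < s -> 2 * s <= 1 - p ->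
  exists2 S : source R, pmax S = p & f p - 8 * s <= redundancy S.
Proof.
move=> hp s0 sp; have [c [c0 c1 g1 g2 g3]] := exists_multiplier hp.
have /andP[p2 p1] := hp.
have ss : s ^+ 2 <= 1 / 4 * s.
  by rewrite expr2; apply: ler_wpM2r; [exact: ltW|move: p2 sp; clear=> *; lra].
have ss0 : 0 < s ^+ 2 by rewrite exprn_gt0.
have ew : 0 < s ^+ 2 < 1 - p.
  by rewrite ss0 /=; move: ss p2 sp s0; clear=> *; lra.
have [S [a [b [ab [card3 pa pb pm HS]]]]] := three_symbol_source p2 ew.
exists S => //; rewrite /redundancy HS.
have ba : prob b <= prob a by rewrite pa pb; move: p2 ss0; clear=> *; lra.
have cs : c * s ^+ 2 <= 1 / 2 * s ^+ 2 by apply: ler_wpM2r => //; exact: ltW.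
have hE : binary_entropy p = eta p + eta (1 - p) by rewrite /binary_entropy /eta; ring.
(* Replacing 1 - p by 1 - p - s^2 costs at most (2 + c) s^2 in each bound. *)
have : f p + binary_entropy p - 3 * s ^+ 2 <= optimal_length S.
  apply: (@optimal_length_ge R S a b ab ba c) => //; rewrite ?c0 ?pa ?pb /=.
  - by move: c1; clear=> *; lra.
  - by move: g1 cs ss0; clear; move: (f p + _) (s ^+ 2) => g e *; lra.
  - by move: g2 cs ss0; clear; move: (f p + _) (s ^+ 2) => g e *; lra.
  - by move: g3 cs ss0; clear; move: (f p + _) (s ^+ 2) => g e *; lra.
have w1 : 1 - p <= 1 by move: p2; clear=> *; lra.
have := eta_sqr_le s0; have := eta_subr_le ew w1.
have k1 : 2 * s / ln 2 <= 4 * s.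
  rewrite ler_pdivrMr ?ln2_gt0 //; have := ler_wpM2l (ltW s0) (ln2_ge R).
  by move: s0 (ln 2); clear=> s0 l *; lra.
have k2 : s ^+ 2 / ln 2 <= s.
  rewrite ler_pdivrMr ?ln2_gt0 //; have := ler_wpM2l (ltW s0) (ln2_ge R).
  by move: s0 ss (ln 2); clear=> s0 ss l *; lra.
rewrite hE; move: s0 k1 k2 ss; clear=> s0.
move: (2 * s / ln 2) (s ^+ 2 / ln 2) => x y.
move: (eta _) (eta _) (eta _) (eta _) => h1 h2 h3 h4.
by move: (s ^+ 2) (f p) (optimal_length S) => *; lra.
Qed.

End WorstCase.

Theorem theorem4 (R : realType) (p : R) (hp : 2^-1 <= p < 1) :
  worst_case_redundancy p = (f p)%:E.
Proof.
apply/le_anti/andP; split.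
  apply: ge_ereal_sup => _ [S Sp <-].
  by rewrite lee_fin -Sp; apply: redundancy_le; rewrite Sp.
apply/lee_addgt0Pr => eps eps0; have /andP[_ p1] := hp.
(* The first argument keeps the loss 8 s below [eps], the second leaves room for the third
   symbol. *)
pose s := Num.min (eps / 8) ((1 - p) / 2).
have s0 : 0 < s by rewrite lt_min; apply/andP; split; lra.
have s1 : s <= eps / 8 by rewrite ge_min lexx.
have s2 : 2 * s <= 1 - p.
  have : s <= (1 - p) / 2 by rewrite ge_min lexx orbT.
  lra.
have [S Sp hS] := redundancy_close hp s0 s2.
rewrite -leeBlDr // -EFinB; apply: le_ereal_sup_tmp.
exists (redundancy S)%:E; first by exists S.
by rewrite lee_fin; lra.
Qed.
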